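(* Let $\mathrm{HA}(2)$ be the hive algebra for $\mathrm{GL}(2)$ (defined in the context with $n=2$). (1) $\mathrm{HA}(2)$ is isomorphic, as a $\mathbb{C}$-algebra, to the polynomial algebra in five indeterminates: \[ \mathrm{HA}(2)\cong \mathbb{C}[x_1,x_2,\ldots,x_5]. \] (2) The Hilbert-Poincaré series $\mathfrak{HP}_2(t)$ of $\mathrm{HA}(2)$ is \[ \mathfrak{HP}_2(t)=\frac{1}{(1-t)^2(1-t^2)^3}=1+2t+6t^2+10t^3+20t^4+30t^5+50t^6+70t^7+105t^8+140t^9+\cdots . \]
   Context: Let $n\ge 1$. A sequence $\kappa=(\kappa_1,\ldots,\kappa_n)\in\mathbb{Z}^n$ is non-negative dominant if $\kappa_1\ge\kappa_2\ge\cdots\ge\kappa_n\ge 0$; write $|\kappa|=\kappa_1+\cdots+\kappa_n$. A triangular array is an array of integers $h=(h_{ij})_{1\le j\le i\le n+1}$. Its boundary is the triple $(\underline{a}_h,\underline{b}_h,\underline{c}_h)$ of sequences in $\mathbb{Z}^n$ with $i$-th entries (for $1\le i\le n$) $a_i=h_{i+1,i+1}-h_{i,i}$, $b_i=h_{i+1,1}-h_{i,1}$, $c_i=h_{n+1,i+1}-h_{n+1,i}$. The rhombus conditions are: (i) $h_{i,j}+h_{i+1,j+1}\ge h_{i+1,j}+h_{i,j+1}$ for $1\le j<i\le n$; (ii) $h_{i,j}+h_{i,j+1}\ge h_{i+1,j+1}+h_{i-1,j}$ for $1\le j<i\le n$; (iii) $h_{i+1,j}+h_{i,j}\ge h_{i+1,j+1}+h_{i,j-1}$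 for $1<j\le i\le n$. A hive for $\mathrm{GL}(n)$ is a triangular array of integers with $h_{11}=0$, satisfying all the rhombus conditions, and such that the three sequences $\underline{a}_h,\underline{b}_h,\underline{c}_h$ of its boundary are non-negative dominant. The set $\mathcal{H}(n)$ of all hives for $\mathrm{GL}(n)$ is a submonoid of $\mathbb{Z}^{(n+1)(n+2)/2}$ under entrywise addition. The hive algebra $\mathrm{HA}(n)$ is the $\mathbb{C}$-subalgebra of the polynomial algebra $\mathbb{C}[z_{ij}:1\le j\le i\le n+1]$ generated by the monomials $\mathbf{z}^h=\prod_{i,j}z_{ij}^{h_{ij}}$ for all $h\in\mathcal{H}(n)$. It is $\mathbb{Z}_{\ge0}$-graded by the degree in $z_{n+1,n+1}$: $\mathbf{z}^h$ has degree $h_{n+1,n+1}$, which equals $|\lambda|=|\mu|+|\nu|$ if $h$ has boundary $(\lambda,\mu,\nu)$. Its Hilbert-Poincaré series is $\mathfrak{HP}_n(t)=\sum_{d\ge0}m_dt^d$, where $m_d$ is the dimension of the degree $d$ homogeneous component of $\mathrm{HA}(n)$. *)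

(* Defs.v *)
From HB Require Import structures.
From mathcomp Require Import all_boot all_order all_algebra.
From mathcomp Require Import boolp classical_sets reals.
From mathcomp Require Import complex mpoly.

Set Implicit Arguments.
Unset Strict Implicit.
Unset Printing Implicit Defensive.

Import Order.TTheory GRing.Theory Num.Theory.

Local Open Scope ring_scope.

Section GeneratedSubalgebra.
Context {K : nzRingType} {A : comAlgType K}.

Definition gen_subalg (G : set A) : pred A := fun x =>
  `[< forall S : {pred A}, GRing.subalg_closed S ->
        (forall g, G g -> g \in S) -> x \in S >].

Lemma gen_subalg_closed (G : set A) : GRing.subsemialg_closed (gen_subalg G).
Proof.
apply: GRing.subalg_closed_semi; split.
- by apply/asboolP => S [].
- move=> a u v /asboolP Gu /asboolP Gv; apply/asboolP => S SS GS.
  by have [_ Slin _] := SS; apply: Slin; [apply: Gu | apply: Gv].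
- move=> u v /asboolP Gu /asboolP Gv; apply/asboolP => S SS GS.
  by have [_ _ SM] := SS; apply: SM; [apply: Gu | apply: Gv].
Qed.

HB.instance Definition _ (G : set A) :=
  GRing.isSubalgClosed.Build K A (gen_subalg G) (gen_subalg_closed G).

Definition gen_alg (G : set A) := {x : A | gen_subalg G x}.

HB.instance Definition _ (G : set A) := SubType.on (gen_alg G).
HB.instance Definition _ (G : set A) := [Choice of gen_alg G by <:].
HB.instance Definition _ (G : set A) :=
  [SubChoice_isSubComNzRing of gen_alg G by <:].
HB.instance Definition _ (G : set A) :=
  [SubZmodule_isSubLmodule of gen_alg G by <:].
HB.instance Definition _ (G : set A) :=
  [SubNzRing_SubLmodule_isSubLalgebra of gen_alg G by <:].
HB.instance Definition _ (G : set A) :=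
  [SubLalgebra_isSubAlgebra of gen_alg G by <:].

End GeneratedSubalgebra.

Definition is_basis (K : nzRingType) (V : lmodType K) (S : set V)
    (m : nat) (b : 'I_m -> V) : Prop :=
  [/\ forall i, S (b i),
      forall c : 'I_m -> K, \sum_(i < m) c i *: b i = 0 -> forall i, c i = 0
    & forall v, S v -> exists c : 'I_m -> K, v = \sum_(i < m) c i *: b i].

(* The value is 0 when there is no finite basis, so a nonzero value also asserts
   finite-dimensionality. *)
Definition dimension (K : nzRingType) (V : lmodType K) (S : set V) : nat :=
  xget 0%N [set m | exists b : 'I_m -> V, is_basis S b].

Record fps (R : Type) := FPS { fps_coef : nat -> R }.

HB.instance Definition _ (R : Type) := gen_eqMixin (fps R).
HB.instance Definition _ (R : Type) := gen_choiceMixin (fps R).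

Lemma fpsP (R : Type) (f g : fps R) :
  (forall n, fps_coef f n = fps_coef g n) -> f = g.
Proof. by case: f g => [f] [g] /= /funext ->. Qed.

Section FpsRing.
Context {R : comNzRingType}.
Implicit Types f g h : fps R.

Definition fps_zero : fps R := FPS (fun=> 0).
Definition fps_one : fps R := FPS (fun n => (n == 0%N)%:R).
Definition fps_opp f := FPS (fun n => - fps_coef f n).
Definition fps_add f g := FPS (fun n => fps_coef f n + fps_coef g n).
Definition fps_mul f g :=
  FPS (fun n => \sum_(i < n.+1) fps_coef f i * fps_coef g (n - i)%N).

Fact fps_addA : associative fps_add.
Proof. by move=> f g h; apply: fpsP => n; apply: addrA. Qed.
Fact fps_addC : commutative fps_add.
Proof. by move=> f g; apply: fpsP => n; apply: addrC. Qed.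
Fact fps_add0 : left_id fps_zero fps_add.
Proof. by move=> f; apply: fpsP => n; apply: add0r. Qed.
Fact fps_addN : left_inverse fps_zero fps_opp fps_add.
Proof. by move=> f; apply: fpsP => n; apply: addNr. Qed.

HB.instance Definition _ :=
  GRing.isZmodule.Build (fps R) fps_addA fps_addC fps_add0 fps_addN.

Let tr n f : {poly R} := \poly_(i < n.+1) fps_coef f i.

Let tr_coef n f i : (i <= n)%N -> (tr n f)`_i = fps_coef f i.
Proof. by move=> le_in; rewrite coef_poly ltnS le_in. Qed.

Let tr_mul n f g i : (i <= n)%N ->
  fps_coef (fps_mul f g) i = (tr n f * tr n g)`_i.
Proof.
move=> le_in; rewrite coefM; apply: eq_bigr => j _.
by rewrite !tr_coef // (leq_trans _ le_in) ?leq_subr // -ltnS.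
Qed.

Fact fps_mulC : commutative fps_mul.
Proof. by move=> f g; apply: fpsP => n; rewrite !(@tr_mul n) // mulrC. Qed.
Fact fps_mulA : associative fps_mul.
Proof.
move=> f g h; apply: fpsP => n; transitivity ((tr n f * (tr n g * tr n h))`_n).
  rewrite coefM; apply: eq_bigr => i _.
  by rewrite tr_coef ?leq_ord // -(@tr_mul n) ?leq_subr.
rewrite mulrA coefM; apply: eq_bigr => i _.
by rewrite -(@tr_mul n) ?leq_ord // tr_coef ?leq_subr.
Qed.
Fact fps_mul1 : left_id fps_one fps_mul.
Proof.
move=> f; apply: fpsP => n /=; rewrite big_ord_recl /= mul1r subn0.
by rewrite big1 ?addr0 // => i _; rewrite mul0r.
Qed.
Fact fps_mulD : left_distributive fps_mul fps_add.
Proof.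
move=> f g h; apply: fpsP => n /=; rewrite -big_split /=.
by apply: eq_bigr => i _; rewrite mulrDl.
Qed.
Fact fps_one_neq0 : fps_one != 0.
Proof.
by apply/eqP => /(congr1 (fun f => fps_coef f 0)) /= /eqP; rewrite oner_eq0.
Qed.

HB.instance Definition _ := GRing.Zmodule_isComNzRing.Build (fps R)
  fps_mulA fps_mulC fps_mul1 fps_mulD fps_one_neq0.

(* Classical inverse: non-invertible series are sent to themselves. *)
Definition fps_unit : pred (fps R) := fun f => `[< exists g, g * f = 1 >].
Definition fps_inv f : fps R := xget f [set g | g * f = 1].

Fact fps_mulV : {in fps_unit, left_inverse 1 fps_inv *%R}.
Proof.
move=> f /asboolP fU; rewrite /fps_inv; case: xgetP => // nU.
by case: fU => g gf; case: (nU g).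
Qed.
Fact fps_unitP f g : g * f = 1 -> fps_unit f.
Proof. by move=> gf; apply/asboolP; exists g. Qed.
Fact fps_inv_out : {in [predC fps_unit], fps_inv =1 id}.
Proof.
move=> f /asboolP fNU; rewrite /fps_inv; case: xgetP => // g _ gf.
by case: fNU; exists g.
Qed.

HB.instance Definition _ := GRing.ComNzRing_hasMulInverse.Build (fps R)
  fps_mulV fps_unitP fps_inv_out.

Definition fps_var : fps R := FPS (fun n => (n == 1%N)%:R).

End FpsRing.

(* The pairs (i, j) with 1 <= j <= i <= n + 1. *)
Definition tri_idx (n : nat) :=
  {ij : 'I_n.+2 * 'I_n.+2 | (0 < ij.2 <= ij.1)%N}.
HB.instance Definition _ (n : nat) := SubType.on (tri_idx n).
HB.instance Definition _ (n : nat) := [Finite of tri_idx n by <:].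

Definition tri_array (n : nat) := {ffun tri_idx n -> int}.

(* The entry h_{ij}, indexed from 1 as in the definition of hives; the default
   value 0 is only met outside the triangle 1 <= j <= i <= n + 1. *)
Definition entry (n : nat) (h : tri_array n) (i j : nat) : int :=
  if insub (inord i, inord j) is Some k then h k else 0.

Section Hive.
Context {n : nat}.
Implicit Type h : tri_array n.

(* The r-th component (r < n) of these tuples is the entry of index r + 1. *)
Definition bdry_a h : n.-tuple int :=
  [tuple entry h r.+2 r.+2 - entry h r.+1 r.+1 | r < n].
Definition bdry_b h : n.-tuple int :=
  [tuple entry h r.+2 1 - entry h r.+1 1 | r < n].
Definition bdry_c h : n.-tuple int :=
  [tuple entry h n.+1 r.+2 - entry h n.+1 r.+1 | r < n].

Definition nonneg_dominant (k : n.-tuple int) : bool :=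
  sorted >=%R k && all (fun x => 0 <= x) k.

Definition rhombus1 h : Prop := forall i j : nat, [&& 1 <= j, j < i & i <= n]%N ->
  entry h i j + entry h i.+1 j.+1 >= entry h i.+1 j + entry h i j.+1.
Definition rhombus2 h : Prop := forall i j : nat, [&& 1 <= j, j < i & i <= n]%N ->
  entry h i j + entry h i j.+1 >= entry h i.+1 j.+1 + entry h i.-1 j.
Definition rhombus3 h : Prop := forall i j : nat, [&& 1 < j, j <= i & i <= n]%N ->
  entry h i.+1 j + entry h i j >= entry h i.+1 j.+1 + entry h i j.-1.

Definition is_hive h : Prop :=
  [/\ entry h 1 1 = 0,
      [/\ rhombus1 h, rhombus2 h & rhombus3 h]
    & [/\ nonneg_dominant (bdry_a h), nonneg_dominant (bdry_b h)
        & nonneg_dominant (bdry_c h)]].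

Let bdry_ge0 (F : 'I_n -> int) (r : 'I_n) :
  nonneg_dominant [tuple F r | r < n] -> 0 <= F r.
Proof.
move=> /andP[_ /allP F0]; apply: F0; apply/tnthP; exists r.
by rewrite tnth_mktuple.
Qed.

Arguments bdry_ge0 {F} r.

Lemma hive_entry_ge0 h i j : is_hive h -> [&& 1 <= j, j <= i & i <= n.+1]%N ->
  0 <= entry h i j.
Proof.
case=> h0 [_ _ h3] [_ hb hc].
have row m a b : (m + a = n)%N -> (1 <= b <= a)%N ->
    entry h a.+1 b <= entry h a.+1 b.+1.
  elim: m a b => [|m IHm] a b; rewrite ?add0n ?addSnnS => def_n /andP[b0 le_ba].
    case: b b0 le_ba => // b _; rewrite def_n => lt_bn.
    by rewrite -subr_ge0 (bdry_ge0 (Ordinal lt_bn) hc).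
  have le1 := IHm a.+1 b.+1 def_n le_ba.
  have lt_an : (a < n)%N by rewrite -def_n leq_addl.
  have := h3 a.+1 b.+1; rewrite !ltnS b0 le_ba lt_an => /(_ isT) /= le2.
  by rewrite -(lerD2l (entry h a.+2 b.+2)) (le_trans le2) // lerD2r.
have col a : (a <= n)%N -> 0 <= entry h a.+1 1.
  elim: a => [|a IHa] lt_an; first by rewrite h0.
  apply: le_trans (IHa (ltnW lt_an)) _.
  by rewrite -subr_ge0 (bdry_ge0 (Ordinal lt_an) hb).
case: i => [|a]; first by case: j.
elim: j => // -[|b] IHb; rewrite /= !ltnS; first by move/col.
move=> /andP[lt_ba le_an]; apply: le_trans (IHb _) _.
  by rewrite /= !ltnS (ltnW lt_ba).
by apply: (row (n - a)%N); rewrite ?subnK.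
Qed.

Lemma hive_ge0 h k : is_hive h -> 0 <= h k.
Proof.
case: k => -[i j] ij hh; have := ij; rewrite /= => /andP[j0 le_ji].
have := @hive_entry_ge0 h i j hh; rewrite j0 le_ji -ltnS ltn_ord => /(_ isT).
by rewrite /entry !inord_val insubT.
Qed.

End Hive.

(* The polynomial ring in the z_ij has as variables 'X_(enum_rank ij), for
   ij : tri_idx n. By hive_ge0, the absolute values have no effect on hives. *)
Definition hive_mnm (n : nat) (h : tri_array n) : 'X_{1..#|{: tri_idx n}|} :=
  [multinom `|h (enum_val k)|%N | k < #|{: tri_idx n}|].

Definition hive_gens (R : realType) (n : nat) :
    set {mpoly R[i][#|{: tri_idx n}|]} :=
  [set 'X_[hive_mnm h] | h in [set h : tri_array n | is_hive h]].
Arguments hive_gens : clear implicits.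

Definition HA (R : realType) (n : nat) := gen_alg (hive_gens R n).

(* The index (n + 1, n + 1). *)
Definition corner (n : nat) : tri_idx n.
Proof. by exists (ord_max, ord_max); rewrite /= leqnn. Defined.

Definition HA_homog (R : realType) (n d : nat) : set (HA R n) :=
  [set p | forall m, m \in msupp (val p) -> m (enum_rank (corner n)) = d].
Arguments HA_homog : clear implicits.

Definition HP (R : realType) (n : nat) : fps int :=
  FPS (fun d => (dimension (HA_homog R n d))%:Z).

(* Main.v *)
Require Import Defs.
From HB Require Import structures.
From mathcomp Require Import all_boot all_order all_algebra.
From mathcomp Require Import boolp classical_sets reals.
From mathcomp Require Import complex mpoly.
From mathcomp Require Import zify.
Import Order.TTheory GRing.Theory Num.Theory.
Local Open Scope ring_scope.

(** A hive for GL(2) is given by [h21, h22, h31, h32, h33], as [h11 = 0]. Its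
    dominance and rhombus conditions amount to the non-negativity of five linear
    forms,
      [x1 = h21 + h22 - h32],  [x2 = h22 + h32 - h21 - h33],  [x3 = h31 - h21],
      [x4 = h33 - h32],        [x5 = h21 + h32 - h22 - h31]
    ([is_hive2P]). These forms are a basis of the lattice dual to Z^5, so the
    monoid of hives is free on the five hives dual to them, which are listed in
    [fund_entries] ([fund_coordsK], [hive_ofK]).

    Part (1): HA(2) is therefore the algebra of a free commutative monoid. The
    substitution sending the k-th variable to the monomial of the k-th
    generating hive maps distinct monomials to distinct monomials, hence is
    injective, and its image is spanned by the hive monomials, which is the
    algebra that they generate ([to_gen_alg_bij]).

    Part (2): the five generators have degree [h33] equal to 1, 1, 2, 2, 2, so
    the component of degree [d] has as basis the monomials whose exponents solve
    [m1 + m2 + 2 m3 + 2 m4 + 2 m5 = d] ([gen_alg_basis], [HP_count]). The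
    generating series of the number of solutions is the product of the
    geometric series [1 / (1 - t^w)] over the weights [w]
    ([fps_count_weighted]), and dividing by one factor after the other gives
    the first coefficients ([fps_coef_iota_geom]). *)

(** * Dimension of a free module with a finite basis *)

Section Dimension.
Context {K : comNzRingType} {V : lmodType K}.

(** The matrices expressing [b] in terms of [c] and [c] in terms of [b] have
    product 1, which bounds the number of rows of the first. *)
Lemma leq_basis {S : set V} {m n : nat} {b : 'I_m -> V} {c : 'I_n -> V} :
  is_basis S b -> is_basis S c -> (m <= n)%N.
Proof.
move=> [Sb bfree bgen] [Sc _ cgen].
have /choice[B bB] := fun i => cgen _ (Sb i).
have /choice[C cC] := fun j => bgen _ (Sc j).
apply: (@mulmx1_min K _ _ (\matrix_(i, j) B i j) (\matrix_(j, k) C j k)).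
apply/matrixP => i k; rewrite !mxE; apply/eqP; rewrite -subr_eq0; apply/eqP.
under eq_bigr do rewrite !mxE.
pose e k := \sum_j B i j * C j k - (i == k)%:R.
apply: (bfree e); rewrite /e.
under eq_bigr do rewrite scalerBl scaler_suml.
have bE : \sum_l (i == l)%:R *: b l = b i.
  rewrite (bigD1 i) //= eqxx scale1r big1 ?addr0 // => l il.
  by rewrite eq_sym (negPf il) scale0r.
rewrite sumrB bE bB exchange_big /=; apply/eqP; rewrite subr_eq0; apply/eqP.
apply: eq_bigr => j _; rewrite [in RHS]cC scaler_sumr.
by apply: eq_bigr => l _; rewrite scalerA.
Qed.

Lemma basis_dimension {S : set V} {m : nat} {b : 'I_m -> V} :
  is_basis S b -> dimension S = m.
Proof.
move=> bS; rewrite /dimension; case: xgetP => [n _ [c cS]|/(_ m)].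
  by apply/eqP; rewrite eqn_leq (leq_basis cS bS) (leq_basis bS cS).
by case; exists b.
Qed.

End Dimension.

(** * Algebras generated by monomials *)

Lemma lrmorphism_inverse (K : nzRingType) (U V : lalgType K)
    (g : {lrmorphism U -> V}) : bijective g ->
  exists f : {lrmorphism V -> U}, bijective f.
Proof.
case=> f gK fK.
pose fA := GRing.isLinear.Build K V U _ f (can2_linear gK fK).
pose fM := GRing.isMonoidMorphism.Build V U f (can2_monoid_morphism gK fK).
pose F : {lrmorphism V -> U} := HB.pack f fA fM.
by exists F; exists g.
Qed.

Section MonomialAlgebra.
Context {K : comNzRingType} {n k : nat} (F : 'I_n -> 'X_{1..k}).

(** The exponent of the monomial obtained from ['X_[m]] when each variable
    ['X_i] is replaced with the monomial ['X_[F i]]. *)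
Definition mnm_comb (m : 'X_{1..n}) : 'X_{1..k} :=
  (\sum_(i < n) F i *+ m i)%MM.

Hypothesis mnm_comb_inj : injective mnm_comb.

(** The substitution of the monomials ['X_[F i]] for the variables. *)
Definition monsub : {mpoly K[n]} -> {mpoly K[k]} :=
  comp_mpoly [tuple 'X_[F i] | i < n].

HB.instance Definition _ := GRing.LRMorphism.on monsub.

Lemma monsubX m : monsub 'X_[m] = 'X_[mnm_comb m].
Proof.
rewrite /monsub comp_mpolyX -mprodXnE.
by apply: eq_bigr => i _; rewrite tnth_mktuple.
Qed.

Lemma monsubE p :
  monsub p = \sum_(m <- msupp p) p@_m *: 'X_[mnm_comb m].
Proof.
rewrite {1}[p]mpolyE linear_sum /=.
by apply: eq_bigr => m _; rewrite linearZ /= monsubX.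
Qed.

Lemma mcoeff_monsub p m : (monsub p)@_(mnm_comb m) = p@_m.
Proof.
rewrite monsubE [in RHS](mpolyE p) !raddf_sum /=; apply: eq_bigr => l _.
by rewrite !mcoeffZ !mcoeffX (inj_eq mnm_comb_inj).
Qed.

Lemma monsub_inj : injective monsub.
Proof.
by move=> p q pq; apply/mpolyP => m; rewrite -!mcoeff_monsub pq.
Qed.

(* G consists of all the products of the monomials 'X_[F i]. *)
Context {G : set {mpoly K[k]}}.
Hypothesis GE : forall x, G x <-> exists m, x = 'X_[mnm_comb m].

Lemma gen_subalg_monsub x : gen_subalg G x <-> exists p, x = monsub p.
Proof.
split=> [/asboolP Gx | [p ->]].
  pose S : {pred {mpoly K[k]}} := fun y => `[< exists p, y = monsub p >].
  (* The image of monsub is a subalgebra that contains G. *)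
  apply/(@asboolP (exists p, x = monsub p)); apply: (Gx S); first split.
  - by apply/asboolP; exists 1; rewrite rmorph1.
  - move=> a u v /asboolP[p ->] /asboolP[q ->]; apply/asboolP.
    by exists (a *: p + q); rewrite linearP.
  - move=> u v /asboolP[p ->] /asboolP[q ->]; apply/asboolP.
    by exists (p * q); rewrite rmorphM.
  - move=> y /GE[m ->]; apply/asboolP; exists 'X_[m].
    by rewrite monsubX.
have : monsub p \in gen_subalg G; last by [].
rewrite monsubE; apply: rpred_sum => m _; apply: rpredZ.
by apply/asboolP => S _; apply; apply/GE; exists m.
Qed.

(** The map [monsub] with codomain restricted to its image, the algebra
    generated by [G]. *)
Definition to_gen_alg (p : {mpoly K[n]}) : gen_alg G :=
  Sub (monsub p) (proj2 (gen_subalg_monsub _) (ex_intro _ p erefl)).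

Lemma val_to_gen_alg p : val (to_gen_alg p) = monsub p.
Proof. by rewrite SubK. Qed.

Fact to_gen_alg_linear : linear to_gen_alg.
Proof.
move=> a p q; apply: val_inj.
by rewrite linearP !val_to_gen_alg linearP.
Qed.

Fact to_gen_alg_monoid : monoid_morphism to_gen_alg.
Proof.
split=> [|p q]; apply: val_inj; first by rewrite val_to_gen_alg !rmorph1.
by rewrite rmorphM !val_to_gen_alg rmorphM.
Qed.

HB.instance Definition _ :=
  GRing.isLinear.Build K {mpoly K[n]} (gen_alg G) _ to_gen_alg
    to_gen_alg_linear.
HB.instance Definition _ :=
  GRing.isMonoidMorphism.Build {mpoly K[n]} (gen_alg G) to_gen_alg
    to_gen_alg_monoid.

Lemma to_gen_alg_surj x : exists p, to_gen_alg p = x.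
Proof.
have /gen_subalg_monsub[p xp] := valP x.
by exists p; apply: val_inj; rewrite val_to_gen_alg -xp.
Qed.

Lemma to_gen_alg_inj : injective to_gen_alg.
Proof.
move=> p q /(congr1 val); rewrite !val_to_gen_alg; exact: monsub_inj.
Qed.

Lemma to_gen_alg_bij : bijective to_gen_alg.
Proof.
have /choice[f fK] := to_gen_alg_surj.
by exists f => // p; apply: to_gen_alg_inj; rewrite fK.
Qed.

(** The elements of the generated algebra whose monomials all satisfy [P] have
    as basis the images of the monomials ['X_[m]] with [P (mnm_comb m)], when
    [mm] enumerates these [m] without repetition. *)
Lemma gen_alg_basis (P : 'X_{1..k} -> Prop) {N : nat}
    {mm : 'I_N -> 'X_{1..n}} :
  injective mm -> (forall m, P (mnm_comb m) <-> exists i, m = mm i) ->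
  is_basis [set p : gen_alg G | forall m, m \in msupp (val p) -> P m]
           (fun i => to_gen_alg 'X_[mm i]).
Proof.
move=> mmI PE; have cE (c : 'I_N -> K) j :
    (\sum_i c i *: 'X_[mm i])@_(mm j) = c j.
  rewrite raddf_sum (bigD1 j) //= mcoeffZ mcoeffX eqxx mulr1 big1 ?addr0 //.
  by move=> i ij; rewrite mcoeffZ mcoeffX (inj_eq mmI) (negPf ij) mulr0.
split=> [i m|c c0 i|v /= Pv].
- rewrite val_to_gen_alg monsubX msuppX inE => /eqP ->.
  by apply/PE; exists i.
- rewrite -cE; suff -> : \sum_i c i *: 'X_[mm i] = 0 by rewrite mcoeff0.
  apply: to_gen_alg_inj; rewrite linear0 linear_sum -[RHS]c0.
  by apply: eq_bigr => j _; rewrite linearZ.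
have [p pv] := to_gen_alg_surj v; exists (fun i => p@_(mm i)).
suff -> : \sum_i p@_(mm i) *: to_gen_alg 'X_[mm i] =
          to_gen_alg (\sum_i p@_(mm i) *: 'X_[mm i]).
  rewrite -pv; congr to_gen_alg; apply/mpolyP => m.
  have [[i ->]|m_out] := pselect (exists i, m = mm i); first by rewrite cE.
  (* An exponent not enumerated by mm occurs on neither side. *)
  transitivity (0 : K).
    apply/eqP; apply: contra_notT m_out; rewrite -mcoeff_monsub -mcoeff_msupp.
    by move=> mv; apply/PE/Pv; rewrite -pv val_to_gen_alg.
  rewrite raddf_sum big1 //= => i _; rewrite mcoeffZ mcoeffX.
  by case: eqP => [mi|]; rewrite ?mulr0 //; case: m_out; exists i.
by rewrite linear_sum; apply: eq_bigr => j _; rewrite linearZ.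
Qed.

End MonomialAlgebra.

(** * Formal power series and weighted counting *)

Section FormalSeries.
Context {R : comNzRingType}.
Implicit Types f g : fps R.

Lemma coef_fpsB f g n : fps_coef (f - g) n = fps_coef f n - fps_coef g n.
Proof. by []. Qed.

Lemma coef_fps_sum (I : Type) (r : seq I) (P : pred I) (F : I -> fps R) n :
  fps_coef (\sum_(i <- r | P i) F i) n = \sum_(i <- r | P i) fps_coef (F i) n.
Proof. by elim/big_rec2: _ => // i x f _ <-. Qed.

Lemma coef_fpsM f g n :
  fps_coef (f * g) n = \sum_(i < n.+1) fps_coef f i * fps_coef g (n - i)%N.
Proof. by []. Qed.

Lemma coef_fps1 n : fps_coef (1 : fps R) n = (n == 0%N)%:R.
Proof. by []. Qed.

Lemma eq_coef_fpsM {f g} h {n} :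
  (forall i, (i <= n)%N -> fps_coef f i = fps_coef g i) ->
  fps_coef (f * h) n = fps_coef (g * h) n.
Proof.
by move=> fg; rewrite !coef_fpsM; apply: eq_bigr => i _; rewrite fg ?leq_ord.
Qed.

Lemma coef_fpsXM f n :
  fps_coef (fps_var * f) n = if n is n'.+1 then fps_coef f n' else 0.
Proof.
rewrite coef_fpsM big_ord_recl mul0r add0r.
case: n => [|n]; first by rewrite big_ord0.
by rewrite big_ord_recl mul1r subSS subn0 big1 ?addr0 // => i _; rewrite mul0r.
Qed.

Lemma coef_fpsXnM f k n : fps_coef (fps_var ^+ k * f) n =
  if (n < k)%N then 0 else fps_coef f (n - k)%N.
Proof.
elim: k n => [|k IHk] n; first by rewrite mul1r subn0.
by rewrite exprS -mulrA coef_fpsXM; case: n => // n; rewrite IHk.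
Qed.

Lemma coef_fpsXn k n : fps_coef (fps_var ^+ k : fps R) n = (n == k)%:R.
Proof.
by rewrite -[_ ^+ k]mulr1 coef_fpsXnM coef_fps1 subn_eq0; case: ltngtP.
Qed.

Lemma coef_fps_geom_recr f w n : fps_coef f n =
  fps_coef (f * (1 - fps_var ^+ w)) n +
  if (n < w)%N then 0 else fps_coef f (n - w)%N.
Proof. by rewrite -coef_fpsXnM mulrBr mulr1 [f * _]mulrC coef_fpsB subrK. Qed.

(** The same recurrence on initial segments of the coefficient sequences: the
    right-hand side computes the coefficients of a quotient by [1 - X^w]. Since
    [ncons w 0 s] shifts [s] by [w] places, its entry at [size s] is the
    coefficient [w] places before the next one, or 0 when there is none. *)
Lemma fps_coef_iota_geom f (w N : nat) :
  (0 < w)%N ->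
  [seq fps_coef f d | d <- iota 0 N] =
  foldl (fun s a => rcons s (a + nth 0 (ncons w 0 s) (size s))) [::]
    [seq fps_coef (f * (1 - fps_var ^+ w)) d | d <- iota 0 N].
Proof.
move=> w0; elim: N => // N IHN.
rewrite -addn1 iotaD !map_cat foldl_cat -IHN /= cats1 add0n; congr rcons.
rewrite [fps_coef f N](coef_fps_geom_recr f w) nth_ncons size_map size_iota.
case: ltnP => // le_wN; rewrite (nth_map 0%N) ?nth_iota ?size_iota //; lia.
Qed.

(** Expanding the product of truncated geometric series counts the weighted
    solutions with bounded coordinates. *)
Lemma fps_prod_geom {n : nat} (w : 'I_n -> nat) (d j : nat) :
  fps_coef (\prod_k \sum_(i < d.+1) (fps_var ^+ w k) ^+ i : fps R) j =
  #|[set f : {ffun 'I_n -> 'I_d.+1} | (\sum_k w k * f k)%N == j]|%:R.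
Proof.
rewrite bigA_distr_bigA /= coef_fps_sum.
rewrite -sum1_card natr_sum [RHS]big_mkcond /=; apply: eq_bigr => f _.
rewrite inE; under eq_bigr do rewrite -exprM.
rewrite -(big_morph (fun m => fps_var ^+ m) (exprD _) (expr0 _)) coef_fpsXn.
by rewrite eq_sym; case: eqP.
Qed.

(** If the coefficient of [f] at [j] is the number of tuples of natural numbers
    [g] with [\sum_k w k * g k = j], then [f] is the inverse of the product of
    the [1 - X^(w k)]. As the weights are positive, the coordinates of a
    solution are at most [j], so that any bound [d >= j] can be imposed on them;
    the hypothesis asks for the count under all these bounds. *)
Lemma fps_count_weighted {n : nat} (w : 'I_n -> nat) (f : fps R) :
  (forall k, 0 < w k)%N ->
  (forall d j, (j <= d)%N -> fps_coef f j =
    #|[set g : {ffun 'I_n -> 'I_d.+1} | (\sum_k w k * g k)%N == j]|%:R) ->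
  f * \prod_k (1 - fps_var ^+ w k) = 1.
Proof.
move=> w0 fE; apply: fpsP => d.
(* Up to degree d, f is a product P of truncated geometric series. *)
pose P : fps R := \prod_k \sum_(i < d.+1) (fps_var ^+ w k) ^+ i.
rewrite (@eq_coef_fpsM _ P) => [|j le_jd]; last by rewrite fps_prod_geom -fE.
rewrite -big_split /=.
rewrite (eq_bigr (fun k => 1 - fps_var ^+ (w k * d.+1))); last first.
  by move=> k _; rewrite mulrC -[1 - _]opprB mulNr -subrX1 opprB -exprM.
(* The factors 1 - X^(w k * (d + 1)) are 1 up to degree d. *)
have trunc k (g : fps R) : fps_coef ((1 - fps_var ^+ (w k * d.+1)) * g) d
    = fps_coef g d.
  rewrite mulrBl mul1r coef_fpsB coef_fpsXnM.
  by rewrite (leq_trans (ltnSn d)) ?subr0 ?leq_pmull.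
apply: (big_rec (fun g : fps R => fps_coef g d = fps_coef 1 d)) => // k x _.
exact: etrans (trunc k x).
Qed.

End FormalSeries.

(** * Triangular arrays *)

Lemma entry_val {n : nat} (h : tri_array n) (ij : tri_idx n) :
  entry h (val ij).1 (val ij).2 = h ij.
Proof. by case: ij => -[i j] ij; rewrite /entry /= !inord_val insubT. Qed.

Lemma entry_ffun {n : nat} (F : nat -> nat -> int) {i j : nat} :
  [&& 0 < j, j <= i & i <= n.+1]%N ->
  entry ([ffun ij : tri_idx n => F (val ij).1 (val ij).2] : tri_array n) i j
    = F i j.
Proof.
move=> /and3P[j0 ji i_n]; have j_n := leq_trans ji i_n.
have ij : (0 < (inord j : 'I_n.+2) <= (inord i : 'I_n.+2))%N.
  by rewrite !inordK ?ltnS ?j0.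
by rewrite /entry insubT ffunE /= !inordK.
Qed.

Lemma eq_entry {n : nat} (h h' : tri_array n) :
  (forall i j, [&& 0 < j, j <= i & i <= n.+1]%N ->
    entry h i j = entry h' i j) -> h = h'.
Proof.
move=> hh'; apply/ffunP => ij; rewrite -!entry_val; apply: hh'.
by case: ij => -[i j] /= /andP[-> ->]; rewrite -ltnS ltn_ord.
Qed.

(** The absolute values taken by [hive_mnm] lose nothing on hives, whose entries
    are non-negative. *)
Lemma hive_mnm_inj {n : nat} {h h' : tri_array n} :
  is_hive h -> is_hive h' -> hive_mnm h = hive_mnm h' -> h = h'.
Proof.
move=> hh hh' e; apply/ffunP => ij.
have := congr1 (fun m : 'X_{1.._} => m (enum_rank ij)) e.
rewrite !mnmE !enum_rankK => /(congr1 Posz).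
by rewrite !gez0_abs ?hive_ge0.
Qed.

Lemma tri3P (P : nat -> nat -> Prop) :
  P 1%N 1%N -> P 2%N 1%N -> P 2%N 2%N ->
  P 3%N 1%N -> P 3%N 2%N -> P 3%N 3%N ->
  forall i j, [&& 0 < j, j <= i & i <= 3]%N -> P i j.
Proof.
by move=> ? ? ? ? ? ? [|[|[|[|i]]]] [|[|[|[|j]]]] //=; rewrite ?andbF.
Qed.

(** * The monoid of hives for GL(2) *)

Lemma nonneg_dominant2 (F : 'I_2 -> int) :
  nonneg_dominant [tuple F r | r < 2] =
  (0 <= F ord_max <= F ord0).
Proof.
rewrite /nonneg_dominant /= /image_mem enum_ordSl enum_ordSl /=.
rewrite (_ : enum _ = [::]) /=; last by apply: size0nil; rewrite size_enum_ord.
rewrite (_ : lift ord0 ord0 = ord_max) /=; last exact: val_inj.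
by rewrite !andbT; lia.
Qed.

(** Of the dominance conditions, only [h31 >= h21] and [h33 >= h32] have to be
    kept: the others follow from these two and the rhombus conditions. *)
Lemma is_hive2P (h : tri_array 2) : is_hive h <->
  [/\ entry h 1 1 = 0,
      [/\ entry h 3 1 + entry h 2 2 <= entry h 2 1 + entry h 3 2,
          entry h 3 2 <= entry h 2 1 + entry h 2 2
        & entry h 3 3 + entry h 2 1 <= entry h 3 2 + entry h 2 2],
      entry h 2 1 <= entry h 3 1 & entry h 3 2 <= entry h 3 3].
Proof.
rewrite /is_hive /bdry_a /bdry_b /bdry_c !nonneg_dominant2 /=; split.
  case=> h11 [r1 r2 r3] [/andP[a0 a1] /andP[b0 b1] /andP[c0 c1]].
  have := (r1 2%N 1%N isT, r2 2%N 1%N isT, r3 2%N 2%N isT) => /= -[[]].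
  by rewrite h11; move=> *; split => //; [split|..]; lia.
case=> h11 [r1 r2 r3] b c; split=> //.
  (* Each rhombus condition has a single instance: (i, j) is (2, 1) for the
     first two, and (2, 2) for the third. *)
  by split=> [] [|[|[|i]]] [|[|[|j]]];
    rewrite ?andbF //= h11 addr0.
by rewrite h11; split; lia.
Qed.

(** The entries at [(i, j)] of the five generating hives. The entry at [(1, 1)]
    is 0 for all of them, which is the default value for the empty list. *)
Definition fund_entries (i j : nat) : seq nat :=
  match i, j with
  | 2, 1 => [:: 1; 0; 1; 0; 1]
  | 2, 2 => [:: 1; 1; 1; 1; 1]
  | 3, 1 => [:: 1; 0; 2; 0; 1]
  | 3, 2 => [:: 1; 1; 2; 1; 2]
  | 3, 3 => [:: 1; 1; 2; 2; 2]
  | _, _ => [::]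
  end%N.

Definition fund_hive (k : 'I_5) : tri_array 2 :=
  [ffun ij : tri_idx 2 =>
     Posz (nth 0%N (fund_entries (val ij).1 (val ij).2) k)].

Definition fund_mnm (k : 'I_5) := hive_mnm (fund_hive k).

(** The value at [m] of the linear form with coefficients [w]. *)
Definition wsum (w : seq nat) (m : 'X_{1..5}) : nat :=
  (\sum_(k < 5) m k * nth 0 w k)%N.

(** The combination of the generating hives with multiplicities [m]. *)
Definition hive_of (m : 'X_{1..5}) : tri_array 2 :=
  [ffun ij : tri_idx 2 => Posz (wsum (fund_entries (val ij).1 (val ij).2) m)].

(** The multiplicities of the generating hives in [h]. On hives the five linear
    forms are non-negative, and the absolute values have no effect. *)
Definition fund_coords (h : tri_array 2) : 'X_{1..5} :=
  [multinom nth 0%N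
     [:: absz (entry h 2 1 + entry h 2 2 - entry h 3 2)%R;
         absz (entry h 2 2 + entry h 3 2 - entry h 2 1 - entry h 3 3)%R;
         absz (entry h 3 1 - entry h 2 1)%R;
         absz (entry h 3 3 - entry h 3 2)%R;
         absz (entry h 2 1 + entry h 3 2 - entry h 2 2 - entry h 3 1)%R] k
   | k < 5].

Lemma wsumE (w : seq nat) (m : 'X_{1..5}) :
  let x (k : nat) (lt_k5 : (k < 5)%N) := m (Ordinal lt_k5) in
  wsum w m =
  (x 0 isT * nth 0 w 0 + x 1 isT * nth 0 w 1 + x 2 isT * nth 0 w 2
   + x 3 isT * nth 0 w 3 + x 4 isT * nth 0 w 4)%N.
Proof.
rewrite /wsum !big_ord_recr big_ord0 /= add0n.
by do !congr addn; congr (_ * _)%N; congr (m _); apply: val_inj.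
Qed.

Lemma entry_hive_of (m : 'X_{1..5}) {i j : nat} :
  [&& 0 < j, j <= i & i <= 3]%N ->
  entry (hive_of m) i j = wsum (fund_entries i j) m.
Proof. exact: (entry_ffun (fun i j => Posz (wsum (fund_entries i j) m))). Qed.

Lemma mnm_comb_fund (m : 'X_{1..5}) :
  mnm_comb fund_mnm m = hive_mnm (hive_of m).
Proof.
apply/mnmP => q; rewrite mnm_sumE mnmE ffunE; apply: eq_bigr => k _.
by rewrite mulmnE mnmE ffunE mulnC.
Qed.

Lemma is_hive_hive_of (m : 'X_{1..5}) : is_hive (hive_of m).
Proof.
apply/is_hive2P; rewrite !entry_hive_of // !wsumE /=.
by split; [|split|..]; lia.
Qed.

Lemma fund_coordsK (h : tri_array 2) : is_hive h -> hive_of (fund_coords h) = h.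
Proof.
move=> /is_hive2P[h11 [r1 r2 r3] b c]; apply: eq_entry; apply: tri3P;
  rewrite entry_hive_of // wsumE !mnmE /=; lia.
Qed.

Lemma hive_ofK (m : 'X_{1..5}) : fund_coords (hive_of m) = m.
Proof.
apply/mnmP => -[k lt_k5]; rewrite mnmE !entry_hive_of // !wsumE /=.
by case: k lt_k5 => [|[|[|[|[|]]]]] lt_k5 //=;
  rewrite (bool_irrelevance lt_k5 isT); lia.
Qed.

(** Distinct monomials in the five generators are distinct hive monomials. *)
Lemma fund_mnm_inj : injective (mnm_comb fund_mnm).
Proof.
move=> m m'; rewrite !mnm_comb_fund => /hive_mnm_inj e.
by rewrite -[m]hive_ofK e ?hive_ofK //; apply: is_hive_hive_of.
Qed.

Lemma hive_gensE (R : realType) (x : {mpoly R[i][#|{: tri_idx 2}|]}) :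
  hive_gens R 2 x <-> exists m, x = 'X_[mnm_comb fund_mnm m].
Proof.
split=> [[h /fund_coordsK hK <-] | [m ->]].
  by exists (fund_coords h); rewrite mnm_comb_fund hK.
by exists (hive_of m); [exact: is_hive_hive_of | rewrite mnm_comb_fund].
Qed.

(** * The Hilbert-Poincare series *)

(** The degrees of the generating hives, that is, their entries at [(3, 3)]. *)
Definition fund_weights := fund_entries 3 3.

Lemma mnm_corner (m : 'X_{1..5}) :
  mnm_comb fund_mnm m (enum_rank (corner 2)) = wsum fund_weights m.
Proof. by rewrite mnm_comb_fund mnmE enum_rankK ffunE. Qed.

Lemma HP_count (R : realType) (D d : nat) : (d <= D)%N ->
  fps_coef (HP R 2) d =
  #|[set f : {ffun 'I_5 -> 'I_D.+1} |
      (\sum_(k < 5) nth 0 fund_weights k * f k)%N == d]|%:R.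
Proof.
move=> le_dD; rewrite natz /=; set A := [set _ | _]; congr Posz.
pose mm (i : 'I_#|A|) : 'X_{1..5} := [multinom val (enum_val i k) | k < 5].
have mm_inj : injective mm.
  move=> i i' e; apply: enum_val_inj; apply/ffunP => k; apply: val_inj.
  by have := congr1 (fun m : 'X_{1..5} => m k) e; rewrite !mnmE.
suff mmE m : mnm_comb fund_mnm m (enum_rank (corner 2)) = d <->
    exists i, m = mm i.
  exact: (basis_dimension (gen_alg_basis _ fund_mnm_inj (@hive_gensE R)
    (fun m => m (enum_rank (corner 2)) = d) mm_inj mmE)).
rewrite mnm_corner; split=> [wm|[i ->]]; last first.
  have := enum_valP i; rewrite inE => /eqP <-.
  by apply: eq_bigr => k _; rewrite mnmE mulnC.
have ltD k : (m k < D.+1)%N.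
  rewrite ltnS (leq_trans _ le_dD) // -wm /wsum (bigD1 k) //=.
  rewrite (leq_trans _ (leq_addr _ _)) // leq_pmulr //.
  by case: k => [[|[|[|[|[|]]]]]].
pose f := [ffun k => Ordinal (ltD k)].
have fA : f \in A.
  by rewrite inE -wm; apply/eqP/eq_bigr => k _; rewrite ffunE mulnC.
exists (enum_rank_in fA f); apply/mnmP => k.
by rewrite mnmE enum_rankK_in // ffunE.
Qed.

Lemma HP_prod (R : realType) :
  HP R 2 * ((1 - fps_var) ^+ 2 * (1 - fps_var ^+ 2) ^+ 3) = 1.
Proof.
rewrite -[RHS](fps_count_weighted
  (fun k : 'I_5 => nth 0%N fund_weights k) (HP R 2)).
- congr (_ * _); rewrite !big_ord_recl big_ord0 /= !expr1 !exprS !expr0.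
  by rewrite !mulr1 -!mulrA.
- by case=> [[|[|[|[|[|]]]]]].
- by move=> D d; apply: HP_count.
Qed.

Theorem theorem2p5 (R : realType) :
  (exists f : {lrmorphism HA R 2 -> {mpoly R[i][5]}}, bijective f) /\
  (HP R 2 = 1 / ((1 - fps_var) ^+ 2 * (1 - fps_var ^+ 2) ^+ 3) /\
   [seq fps_coef (HP R 2) d | d <- iota 0 10] =
     [:: 1; 2; 6; 10; 20; 30; 50; 70; 105; 140]).
Proof.
have HP1 := HP_prod R; split; last split.
- apply: lrmorphism_inverse.
  exact: (to_gen_alg_bij _ fund_mnm_inj (@hive_gensE R)).
- set Q := (_ ^+ 2 * _ ^+ 3) in HP1 *; have QU : Q \is a GRing.unit.
    by apply/unitrP; exists (HP R 2); rewrite [Q * _]mulrC HP1.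
  by rewrite div1r -[LHS](mulrK QU) HP1 mul1r.
(* 1 - X is written as 1 - X^1 for the division lemma. *)
have HP2 : HP R 2 * (1 - fps_var ^+ 2) * (1 - fps_var ^+ 2)
    * (1 - fps_var ^+ 2) * (1 - fps_var ^+ 1) * (1 - fps_var ^+ 1) = 1.
  rewrite -[RHS]HP1 expr1; move: (1 - fps_var) (1 - fps_var ^+ 2) => a b.
  by rewrite [a ^+ 2 * _]mulrC !exprS !expr0 !mulr1 !mulrA.
do 3 rewrite (fps_coef_iota_geom _ 2) //.
by do 2 rewrite (fps_coef_iota_geom _ 1) //; rewrite HP2.
Qed.
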